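(* Let $k\geq 2$ be an integer and, for $n\geq 0$, let $f_{k,n}$ denote the number of cyclic odd-up words over $k$ of length $n$. Let $F_k(x)=\sum_{n\geq 0}f_{k,n}x^n$. Then \[F_k(x)=1+x\left(\left\lfloor\frac{k+1}{2}\right\rfloor+\frac{\left\lfloor\frac{k+2}{2}\right\rfloor(x+1)^{\lfloor k/2\rfloor}-1}{x+2-(x+1)^{\lfloor (k+2)/2\rfloor}}\right).\]
   Context: For an integer $k\geq 2$, let $[k]=\{1,\ldots,k\}$. A word over $k$ of length $n$ is an element $w_1\cdots w_n\in[k]^n$. A word $w_1\cdots w_n$ with $n\geq 2$ is cyclic odd-up if for every $i\in[n]$, whenever $w_i$ is odd, $w_{i+1}>w_i$, where $w_{n+1}$ is defined to be $w_1$. By convention, the empty word (length $0$) and every word of length $1$ (i.e., each of the $k$ single letters) are counted as cyclic odd-up. *)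

(* Defs.v *)
From HB Require Import structures.
From mathcomp Require Import all_boot all_order all_algebra.
From mathcomp Require Import boolp.

Set Implicit Arguments.
Unset Strict Implicit.
Unset Printing Implicit Defensive.

Import GRing.Theory.
Local Open Scope ring_scope.

(* The ring R[[x]] of formal power series, as coefficient sequences with the
   Cauchy product. *)
Record fps (R : Type) : Type := FPS { fps_coef : nat -> R }.

Lemma fpsP (R : Type) (f g : fps R) : fps_coef f =1 fps_coef g <-> f = g.
Proof. by case: f g => f [g]; split=> [/= /funext-> | ->]. Qed.

HB.instance Definition _ (R : Type) := gen_eqMixin (fps R).
HB.instance Definition _ (R : Type) := gen_choiceMixin (fps R).

Section FpsZmodule.
Variable R : zmodType.
Implicit Types f g h : fps R.

Definition fps_zero : fps R := FPS (fun=> 0).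
Definition fps_opp f : fps R := FPS (fun n => - fps_coef f n).
Definition fps_add f g : fps R := FPS (fun n => fps_coef f n + fps_coef g n).

Fact fps_addA : associative fps_add.
Proof. by move=> f g h; apply/fpsP => n; apply: addrA. Qed.
Fact fps_addC : commutative fps_add.
Proof. by move=> f g; apply/fpsP => n; apply: addrC. Qed.
Fact fps_add0 : left_id fps_zero fps_add.
Proof. by move=> f; apply/fpsP => n; apply: add0r. Qed.
Fact fps_addN : left_inverse fps_zero fps_opp fps_add.
Proof. by move=> f; apply/fpsP => n; apply: addNr. Qed.

HB.instance Definition _ :=
  GRing.isZmodule.Build (fps R) fps_addA fps_addC fps_add0 fps_addN.

Lemma fps_coef0 n : fps_coef (0 : fps R) n = 0. Proof. by []. Qed.
Lemma fps_coefN f n : fps_coef (- f) n = - fps_coef f n. Proof. by []. Qed.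
Lemma fps_coefD f g n : fps_coef (f + g) n = fps_coef f n + fps_coef g n.
Proof. by []. Qed.
Lemma fps_coefB f g n : fps_coef (f - g) n = fps_coef f n - fps_coef g n.
Proof. by []. Qed.
Lemma fps_coef_sum (I : Type) (r : seq I) (P : pred I) (F : I -> fps R) n :
  fps_coef (\sum_(i <- r | P i) F i) n = \sum_(i <- r | P i) fps_coef (F i) n.
Proof. exact: (big_morph (fun f => fps_coef f n)). Qed.

End FpsZmodule.

Section FpsRing.
Variable R : comNzRingType.
Implicit Types f g h : fps R.

Definition fpsC (c : R) : fps R := FPS (fun n => if n == 0%N then c else 0).
Definition fps_mul f g : fps R :=
  FPS (fun n => \sum_(i < n.+1) fps_coef f i * fps_coef g (n - i)).

(* Truncation to polynomials, used to inherit the ring axioms. *)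
Definition fps_trunc m f : {poly R} := \poly_(i < m.+1) fps_coef f i.

Lemma coef_trunc m f n : (n <= m)%N -> (fps_trunc m f)`_n = fps_coef f n.
Proof. by move=> le_nm; rewrite coef_poly ltnS le_nm. Qed.

Lemma coef_mul_eq (p p' q q' : {poly R}) m :
    (forall n, (n <= m)%N -> p`_n = p'`_n) ->
    (forall n, (n <= m)%N -> q`_n = q'`_n) ->
  (p * q)`_m = (p' * q')`_m.
Proof.
move=> eqp eqq; rewrite !coefM; apply: eq_bigr => i _.
by rewrite eqp ?eqq ?leq_subr // -ltnS.
Qed.

Lemma coef_trunc_mul m f g n : (n <= m)%N ->
  fps_coef (fps_mul f g) n = (fps_trunc m f * fps_trunc m g)`_n.
Proof.
move=> le_nm; rewrite coefM; apply: eq_bigr => i _.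
rewrite !coef_trunc ?(leq_trans (leq_subr _ _)) //.
by rewrite (leq_trans _ le_nm) // -ltnS.
Qed.

Fact fps_mulA : associative fps_mul.
Proof.
move=> f g h; apply/fpsP => m; rewrite !(@coef_trunc_mul m) //.
transitivity (fps_trunc m f * (fps_trunc m g * fps_trunc m h))`_m.
  apply: coef_mul_eq => // n le_nm.
  by rewrite coef_trunc // (coef_trunc_mul _ _ le_nm).
rewrite mulrA; apply: coef_mul_eq => // n le_nm.
by rewrite coef_trunc // (coef_trunc_mul _ _ le_nm).
Qed.

Fact fps_mulC : commutative fps_mul.
Proof.
by move=> f g; apply/fpsP => m; rewrite !(@coef_trunc_mul m) // mulrC.
Qed.

Fact fps_mul1 : left_id (fpsC 1) fps_mul.
Proof.
move=> f; apply/fpsP => n /=; rewrite big_ord_recl /= mul1r subn0.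
by rewrite big1 ?addr0 // => i _; rewrite mul0r.
Qed.

Fact fps_mulDl : left_distributive fps_mul +%R.
Proof.
move=> f g h; apply/fpsP => n; rewrite fps_coefD -big_split /=.
by apply: eq_bigr => i _; rewrite mulrDl.
Qed.

Fact fps_1neq0 : fpsC 1 != 0.
Proof. by apply/eqP => /fpsP/(_ 0%N)/eqP; rewrite /= oner_eq0. Qed.

HB.instance Definition _ := GRing.Zmodule_isComNzRing.Build (fps R)
  fps_mulA fps_mulC fps_mul1 fps_mulDl fps_1neq0.

Definition fpsX : fps R := FPS (fun n => if n == 1%N then 1 else 0).

Lemma fps_coefC c n : fps_coef (fpsC c) n = if n == 0%N then c else 0.
Proof. by []. Qed.
Lemma fps_coef1 n : fps_coef (1 : fps R) n = if n == 0%N then 1 else 0.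
Proof. by []. Qed.
Lemma fps_coefX n : fps_coef fpsX n = if n == 1%N then 1 else 0.
Proof. by []. Qed.
Lemma fps_coefM f g n :
  fps_coef (f * g) n = \sum_(i < n.+1) fps_coef f i * fps_coef g (n - i).
Proof. by []. Qed.
Lemma fps_coef0M f g : fps_coef (f * g) 0 = fps_coef f 0 * fps_coef g 0.
Proof. by rewrite fps_coefM big_ord1. Qed.
Lemma fps_coef0X f m : fps_coef (f ^+ m) 0 = fps_coef f 0 ^+ m.
Proof. by elim: m => // m IHm; rewrite !exprS fps_coef0M IHm. Qed.

Lemma fps_coefCM c f n : fps_coef (fpsC c * f) n = c * fps_coef f n.
Proof.
rewrite fps_coefM big_ord_recl subn0 big1 ?addr0 // => i _.
exact: mul0r.
Qed.

Lemma fps_coef_exp_lt f m n :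
  fps_coef f 0 = 0 -> (n < m)%N -> fps_coef (f ^+ m) n = 0.
Proof.
move=> f0; elim: m n => // m IHm n; rewrite ltnS => le_nm.
rewrite exprS fps_coefM big1 // => -[[|i] lt_in] _ /=; first by rewrite f0 mul0r.
by rewrite IHm ?mulr0 // (leq_trans _ le_nm) // ltn_subrL; case: (n) lt_in.
Qed.

End FpsRing.

Arguments fpsX {R}.

Section FpsUnitRing.
Variable R : comUnitRingType.
Implicit Types f g h : fps R.

Definition fps_unit : pred (fps R) := fun f => fps_coef f 0 \is a GRing.unit.

(* If f = u (1 - h) with u = f(0) a unit, then h(0) = 0 and
   f^-1 = u^-1 \sum_m h^m, where only the terms m <= n contribute to x^n. *)
Definition fps_inv f : fps R :=
  if fps_unit f then
    let v := (fps_coef f 0)^-1 in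
    FPS (fun n => v * fps_coef (\sum_(m < n.+1) (1 - fpsC v * f) ^+ m) n)
  else f.

Fact fps_mulV : {in fps_unit, left_inverse 1 fps_inv *%R}.
Proof.
move=> f Uf; have {}Uf: fps_unit f by [].
rewrite /fps_inv Uf; set v := _^-1; set h := 1 - _.
have h0 : fps_coef h 0 = 0.
  by rewrite fps_coefB fps_coefCM fps_coef1 /= mulVr ?subrr.
have -> : f = fpsC (fps_coef f 0) * (1 - h).
  rewrite subKr; apply/fpsP => n.
  by rewrite !fps_coefCM mulrA mulrV ?mul1r.
set u := fps_coef f 0; rewrite mulrCA; apply/fpsP => n.
set s := FPS _.
have sE i : (i <= n)%N ->
    fps_coef s i = fps_coef (fpsC v * \sum_(m < n.+1) h ^+ m) i.
  move=> le_in; rewrite fps_coefCM /=; congr (_ * _).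
  rewrite !fps_coef_sum (big_ord_widen n.+1 (fun m => fps_coef (h ^+ m) i)) //.
  rewrite big_mkcond; apply: eq_bigr => m _.
  by case: ltnP => // lt_im; rewrite fps_coef_exp_lt.
have -> : fps_coef (fpsC u * (s * (1 - h))) n =
    fps_coef (fpsC u * (fpsC v * (\sum_(m < n.+1) h ^+ m) * (1 - h))) n.
  rewrite !fps_coefCM; congr (_ * _); rewrite !fps_coefM.
  by apply: eq_bigr => i _; rewrite sE // -ltnS.
rewrite -mulrA [X in fpsC v * X]mulrC.
have -> : (1 - h) * (\sum_(m < n.+1) h ^+ m) = 1 - h ^+ n.+1.
  by rewrite -opprB mulNr -subrX1 opprB.
rewrite !fps_coefCM mulrA mulrV // mul1r fps_coefB fps_coef_exp_lt //.
by rewrite subr0.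
Qed.

Fact fps_unitPl f g : g * f = 1 -> fps_unit f.
Proof.
move=> /fpsP/(_ 0%N); rewrite fps_coef0M fps_coef1 /= => gf1.
by apply/unitrPr; exists (fps_coef g 0); rewrite mulrC.
Qed.

Fact fps_inv_out : {in [predC fps_unit], fps_inv =1 id}.
Proof. by move=> f; rewrite inE /= /fps_inv => /negPf; rewrite -topredE /= => ->. Qed.

HB.instance Definition _ := GRing.ComNzRing_hasMulInverse.Build (fps R)
  fps_mulV fps_unitPl fps_inv_out.

Lemma fps_unitE f : (f \is a GRing.unit) = (fps_coef f 0 \is a GRing.unit).
Proof. by []. Qed.

End FpsUnitRing.

(* The ordinal a : 'I_k stands for the letter a + 1 of [k] = {1, ..., k}. *)
Definition letter k (a : 'I_k) : nat := a.+1.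

(* Positions are 0-based; ordS i is the cyclic successor (i + 1) mod n. *)
Definition cyclic_odd_up k n (w : n.-tuple 'I_k) : bool :=
  (n <= 1)%N ||
  [forall i : 'I_n, odd (letter (tnth w i)) ==>
     (letter (tnth w i) < letter (tnth w (ordS i)))%N].

Definition num_cyclic_odd_up (k n : nat) : nat :=
  #|[set w : n.-tuple 'I_k | cyclic_odd_up w]|.

Definition cyclic_odd_up_gf (k : nat) : fps rat :=
  FPS (fun n => (num_cyclic_odd_up k n)%:R).

(* The denominator below is invertible in Q[[x]], so the quotient in the main
   statement is a genuine one. *)
Lemma denominator_unit (m : nat) :
  (fpsX + 2 - (fpsX + 1) ^+ m : fps rat) \is a GRing.unit.
Proof.
rewrite fps_unitE fps_coefB fps_coef0X !fps_coefD fps_coefX fps_coef1 /=.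
by rewrite !add0r expr1n.
Qed.

(* Main.v *)
(* For n >= 2 the cyclic odd-up words are the closed walks of length n of a
   relation on letters, so they are counted by tr A^n. Here A = N + v u is a
   rank-one update of a strictly upper triangular matrix N: the rows of N are
   the odd letters, v is the indicator of the even letters and u = (1, ..., 1).
   With Q = (1 - x N)^-1 this gives
     sum_n tr (A^n) x^n = k + x (u Q Q v) / (1 - x (u Q v)),
   and the vectors Q v and Q Q v are solved for explicitly by back
   substitution. *)
Require Import Defs.
From mathcomp Require Import all_boot all_order all_algebra.
From mathcomp Require Import ring zify.

Import GRing.Theory.
Local Open Scope ring_scope.

(** * Closed walks of a relation and traces of matrix powers *)

Lemma big_tuple_cons (R : Type) (idx : R) (op : Monoid.com_law idx)
    (T : finType) (n : nat) (F : n.+1.-tuple T -> R) :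
  \big[op/idx]_(w : n.+1.-tuple T) F w =
  \big[op/idx]_(a : T) \big[op/idx]_(p : n.-tuple T) F [tuple of a :: p].
Proof.
rewrite pair_bigA /=.
rewrite (reindex (fun ap : T * n.-tuple T => [tuple of ap.1 :: ap.2])) //.
exists (fun w : n.+1.-tuple T => (thead w, [tuple of behead w])).
  by case=> a p _; congr (_, _); apply: val_inj.
by move=> w _ /=; rewrite -tuple_eta.
Qed.

Definition rel_mx (R : nzRingType) (k : nat) (e : rel 'I_k) : 'M[R]_k :=
  \matrix_(i, j) (e i j)%:R.

Section ClosedWalks.

Variables (R : nzRingType) (k : nat) (e : rel 'I_k).

(** The tuple [p] lists the interior vertices of a walk from [a] to [b], so [n] of them make [n.+1]
    steps. *)
Lemma sum_path_rel_mx (n : nat) (a b : 'I_k) :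
  \sum_(p : n.-tuple 'I_k) (path e a (rcons p b))%:R = (rel_mx R k e ^+ n.+1) a b.
Proof.
elim: n a => [|n IHn] a.
  rewrite expr1 mxE (bigD1 [tuple]) //= big1 ?addr0 ?andbT //.
  by move=> p; rewrite (tuple0 p) => /eqP[].
rewrite big_tuple_cons exprS mxE; apply: eq_bigr => c _.
rewrite -IHn mxE mulr_sumr; apply: eq_bigr => p _.
by rewrite /= -natrM mulnb.
Qed.

Lemma sum_cycle_rel_mx (n : nat) :
  \sum_(w : n.+1.-tuple 'I_k) (cycle e w)%:R = \tr (rel_mx R k e ^+ n.+1).
Proof.
by rewrite big_tuple_cons; apply: eq_bigr => a _; rewrite -sum_path_rel_mx.
Qed.

Lemma cycle_tnth (n : nat) (w : n.-tuple 'I_k) :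
  cycle e w = [forall i : 'I_n, e (tnth w i) (tnth w (ordS i))].
Proof.
case: n w => [|n] w; first by rewrite tuple0 /=; apply/esym/forallP => -[].
(* Position [i] after the head is position [i + 1] of the cyclic word; at [i = n] both sides wrap
   around to [a]. *)
have nth_rcons_cycle a (p : n.-tuple 'I_k) i : (i < n.+1)%N ->
    nth a (rcons p a) i = nth a (a :: p) (i.+1 %% n.+1).
  rewrite ltnS leq_eqVlt => /predU1P[->|lt_in].
    by rewrite modnn nth_rcons size_tuple ltnn eqxx.
  by rewrite modn_small // nth_rcons size_tuple lt_in.
case/tupleP: w => a p.
have sz_p : size (rcons p a) = n.+1 by rewrite size_rcons size_tuple.
have tnthE (i : 'I_n.+1) : tnth [tuple of a :: p] i = nth a (a :: rcons p a) i.
  rewrite (tnth_nth a) -rcons_cons nth_rcons /=.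
  by rewrite size_tuple ltn_ord.
have tnthSE (i : 'I_n.+1) : tnth [tuple of a :: p] (ordS i) = nth a (rcons p a) i.
  by rewrite (tnth_nth a) nth_rcons_cycle.
apply/(pathP a)/forallP => [H i | H i].
  by rewrite tnthE tnthSE; apply: H; rewrite sz_p.
by rewrite sz_p => lt_in; have := H (Ordinal lt_in); rewrite tnthE tnthSE.
Qed.

End ClosedWalks.

(** * Power series coefficients and the resolvent of a matrix *)

Lemma fps_coefXM0 (R : comNzRingType) (f : fps R) : fps_coef (fpsX * f) 0 = 0.
Proof. by rewrite fps_coef0M fps_coefX mul0r. Qed.

Lemma fps_coefXMS (R : comNzRingType) (f : fps R) (n : nat) :
  fps_coef (fpsX * f) n.+1 = fps_coef f n.
Proof.
rewrite fps_coefM big_ord_recl fps_coefX mul0r add0r big_ord_recl big1.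
  by rewrite addr0 fps_coefX mul1r subSS subn0.
by move=> i _; rewrite fps_coefX mul0r.
Qed.

Lemma fps_natr (R : comNzRingType) (m : nat) : m%:R = fpsC (m%:R : R).
Proof.
elim: m => [|m IHm]; apply/fpsP => q; first by rewrite fps_coefC; case: ifP.
rewrite -!natr1 IHm fps_coefD !fps_coefC.
by case: ifP; rewrite ?addr0.
Qed.

(** The resolvent [(1 - x A)^-1], expanded entrywise as a geometric series. *)
Definition geom_mx (R : comNzRingType) (n : nat) (A : 'M[R]_n) : 'M[fps R]_n :=
  \matrix_(i, j) FPS (fun m => (A ^+ m) i j).

Section GeometricMatrix.

Variables (R : comNzRingType) (n : nat) (A : 'M[R]_n).

(** The product telescopes: its coefficient of [x^(m+1)] is [A^(m+1) - A^m A]. *)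
Lemma geom_mxM_subX :
  geom_mx R n A *m (1%:M - fpsX *: map_mx (fpsC (R:=R)) A) = 1%:M.
Proof.
rewrite mulmxBr mulmx1 -scalemxAr; apply/matrixP => i j.
rewrite !mxE; apply/fpsP => -[|m]; rewrite fps_coefB.
  by rewrite fps_coefXM0 subr0 /= expr0 mxE; case: eqP.
rewrite fps_coefXMS fps_coef_sum.
rewrite (eq_bigr (fun l => (A ^+ m) i l * A l j)); last first.
  by move=> l _; rewrite !mxE mulrC fps_coefCM mulrC.
rewrite [fps_coef (FPS _) _]/= exprSr mxE subrr.
by case: eqP.
Qed.

Lemma fps_coef_mxtrace_geom (m : nat) :
  fps_coef (\tr (geom_mx R n A)) m = \tr (A ^+ m).
Proof. by rewrite fps_coef_sum; apply: eq_bigr => i _; rewrite mxE. Qed.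

Lemma strict_upper_expr_diag (m : nat) (i : 'I_n) :
  (forall i j : 'I_n, (j <= i)%N -> A i j = 0) -> (A ^+ m.+1) i i = 0.
Proof.
(* The induction needs all entries on or below the diagonal, not just the diagonal ones. *)
move=> upA; have up (i' j : 'I_n) : (j <= i')%N -> (A ^+ m.+1) i' j = 0.
  elim: m i' j => [|m IHm] i' j le_ji; first by rewrite expr1 upA.
  rewrite exprS mxE big1 // => l _.
  have [le_li|lt_il] := leqP l i'; first by rewrite upA // mul0r.
  by rewrite IHm ?mulr0 // (leq_trans le_ji (ltnW lt_il)).
exact: up.
Qed.

Lemma mxtrace_geom_strict_upper :
  (forall i j : 'I_n, (j <= i)%N -> A i j = 0) -> \tr (geom_mx R n A) = n%:R.
Proof.
move=> upA; apply/fpsP => m; rewrite fps_coef_mxtrace_geom.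
rewrite fps_natr fps_coefC; case: m => [|m]; first by rewrite expr0 mxtrace1.
by rewrite /mxtrace big1 // => i _; rewrite strict_upper_expr_diag.
Qed.

End GeometricMatrix.

(* Multiplying the resolvent identity for S by Q gives S = Q + x S v u Q; its
   trace reduces to the scalar u Q S v, and S v is a multiple of Q v. *)
Lemma mxtrace_resolvent_rank1 (R : comNzRingType) (n : nat) (x : R)
    (N Q S : 'M[R]_n) (u : 'rV[R]_n) (v : 'cV[R]_n) :
    Q *m (1%:M - x *: N) = 1%:M -> S *m (1%:M - x *: (N + v *m u)) = 1%:M ->
  (1 - x * (u *m (Q *m v)) 0 0) * (\tr S - \tr Q) =
    x * (u *m (Q *m (Q *m v))) 0 0.
Proof.
move=> /mulmx1C QN SA.
have eS : S = Q + x *: (S *m v *m (u *m Q)).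
  rewrite -{1}[S]mulmx1 -QN.
  have -> : 1%:M - x *: N = 1%:M - x *: (N + v *m u) + x *: (v *m u).
    by rewrite scalerDr opprD addrA subrK.
  by rewrite !mulmxA mulmxDr SA mulmxDl mul1mx -scalemxAr -scalemxAl !mulmxA.
have eSv : (1 - x * (u *m (Q *m v)) 0 0) *: (S *m v) = Q *m v.
  rewrite scalerBl scale1r {1}eS mulmxDl -scalemxAl -!mulmxA.
  rewrite [X in S *m (v *m X)]mx11_scalar mul_mx_scalar -scalemxAr scalerA.
  by rewrite addrK.
rewrite {1}eS mxtraceD addrAC subrr add0r mxtraceZ mxtrace_mulC mulrCA; congr (_ * _).
by rewrite -mxtraceZ scalemxAr eSv -mulmxA /mxtrace big_ord1.
Qed.

(* With 0-based letters, the even j are the odd letters, and (k - j)./2 is the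
   number of even letters exceeding letter j. *)
Lemma sum_alternating_tail (R : comNzRingType) (c : R) (a T : nat -> R) (k i : nat) :
    a 0%N = 0 -> T 0%N = 0 ->
    (forall t, T t.+1 = c * (a t.+1 + 1) + T t) ->
    ~~ odd i -> (i <= k)%N ->
  c * (\sum_(i <= j < k) (if odd j then 1 else a (k - j)./2)) = T (k - i)./2.
Proof.
move=> a0 T0 TS; move def_t: (k - i)./2 => t.
elim: t i def_t => [|t IHt] i def_t even_i le_ik.
  have [->|->] : k = i \/ k = i.+1 by lia.
    by rewrite big_geq // mulr0 T0.
  by rewrite big_nat1 (negPf even_i) subSn // subnn a0 mulr0 T0.
rewrite big_ltn; last by lia.
rewrite big_ltn; last by lia.
rewrite /= even_i (negPf even_i) def_t addrA mulrDr TS; congr (_ + _).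
by apply: IHt; lia.
Qed.

(** * The odd-up relation and the back substitution *)

Section OddUp.

Variable k : nat.

Local Notation X := (fpsX : fps rat).

Definition odd_up_rel : rel 'I_k :=
  fun i j => odd (letter i) ==> (letter i < letter j)%N.

(** The matrix of this relation is [N]; index [i] is the letter [i + 1], so [~~ odd i] picks the odd
    letters. *)
Definition odd_rise_rel : rel 'I_k := fun i j => ~~ odd i && (i < j)%N.

Definition even_letter_cv (R : nzRingType) : 'cV[R]_k := \col_i (odd i)%:R.

Lemma odd_up_rel_mx (R : nzRingType) :
  rel_mx R k odd_up_rel =
    rel_mx R k odd_rise_rel + even_letter_cv R *m const_mx 1.
Proof.
apply/matrixP => i j; rewrite !mxE big_ord1 !mxE mulr1.
rewrite /odd_up_rel /odd_rise_rel /letter /= ltnS.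
by case: (odd i); rewrite ?add0r ?addr0.
Qed.

Lemma map_rel_mx (R : comNzRingType) (e : rel 'I_k) :
  map_mx (fpsC (R:=R)) (rel_mx R k e) = rel_mx (fps R) k e.
Proof.
apply/matrixP => i j; rewrite !mxE; apply/fpsP => m.
by case: (e i j); rewrite fps_coefC //; case: ifP.
Qed.

(** The common shape of [v] (where [a] is zero), [Q v] and [Q Q v]: an odd letter's entry depends
    only on how many even letters exceed it. *)
Definition alt_cv (a : nat -> fps rat) : 'cV[fps rat]_k :=
  \col_(i < k) (if odd i then 1 else a (k - i)./2).

(** Rows of [N] at even letters vanish. At an odd letter with [t] even letters above it, [T t] is
    [X] times the sum of the entries from that letter on; [N] skips the letter itself, leaving
    [a t - (T t - X * a t)]. *)
Lemma rise_alt_cv (a b T : nat -> fps rat) :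
    a 0%N = 0 -> T 0%N = 0 ->
    (forall t, T t.+1 = X * (a t.+1 + 1) + T t) ->
    (forall t, (1 + X) * a t - T t = b t) ->
  (1%:M - X *: rel_mx _ k odd_rise_rel) *m alt_cv a = alt_cv b.
Proof.
move=> a0 T0 TS eb; apply/matrixP => i o.
rewrite mulmxBl mul1mx -scalemxAl !mxE.
case: ifP => odd_i.
  rewrite big1 ?mulr0 ?subr0 // => j _; rewrite !mxE.
  by rewrite /odd_rise_rel odd_i mul0r.
have := @sum_alternating_tail _ X a T k i a0 T0 TS (negbT odd_i) (ltnW (ltn_ord i)).
rewrite big_ltn // odd_i big_geq_mkord mulrDr -eb => <-.
rewrite (eq_bigr (fun j : 'I_k => if (i < j)%N then
          (if odd j then 1 else a (k - j)./2) else 0)); last first.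
  move=> j _; rewrite !mxE /odd_rise_rel odd_i /=.
  by case: ltnP; rewrite ?mul1r ?mul0r.
rewrite -big_mkcond /=; set s := bigop _ _ _; ring.
Qed.

Lemma sum_alt_cv (a T : nat -> fps rat) :
    a 0%N = 0 -> T 0%N = 0 ->
    (forall t, T t.+1 = X * (a t.+1 + 1) + T t) ->
  X * ((const_mx 1 : 'rV_k) *m alt_cv a) 0 0 = T k./2.
Proof.
move=> a0 T0 TS.
have := @sum_alternating_tail _ X a T k 0 a0 T0 TS isT (leq0n k).
rewrite subn0 => <-; congr (_ * _); rewrite mxE big_mkord.
by apply: eq_bigr => i _; rewrite !mxE mul1r.
Qed.

Lemma mxtrace_geom_odd_up :
  (X + 2 - (X + 1) ^+ k./2.+1) *
    (\tr (geom_mx rat k (rel_mx rat k odd_up_rel)) - k%:R) =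
  X * (k./2.+1%:R * (X + 1) ^+ k./2 - 1).
Proof.
pose N := rel_mx (fps rat) k odd_rise_rel.
pose Q := geom_mx rat k (rel_mx rat k odd_rise_rel).
have QN : Q *m (1%:M - X *: N) = 1%:M.
  by rewrite /N -map_rel_mx geom_mxM_subX.
have trQ : \tr Q = k%:R.
  apply: mxtrace_geom_strict_upper => i j le_ji.
  by rewrite mxE /odd_rise_rel ltnNge le_ji andbF.
have SA := geom_mxM_subX rat k (rel_mx rat k odd_up_rel).
rewrite map_rel_mx (odd_up_rel_mx (fps rat)) in SA.
have := mxtrace_resolvent_rank1 _ _ _ _ _ _ _ _ QN SA.
rewrite trQ.
(* Differencing [(1 + X) * a t - T t = 0] in [t] gives [a t.+1 = (1 + X) * a t + X], hence this [a].
   The same with right-hand side [a t] gives [b] and its tail sums [U]. The truncated [t.-1] at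
   [t = 0] is harmless, its coefficient being zero. *)
pose a t : fps rat := (1 + X) ^+ t - 1.
pose T t : fps rat := (1 + X) ^+ t.+1 - 1 - X.
pose b t : fps rat := (1 + X) ^+ t - 1 + t%:R * X * (1 + X) ^+ t.-1.
pose U t : fps rat := X * (t.+1%:R * (1 + X) ^+ t - 1).
have a0 : a 0%N = 0 by rewrite /a expr0 subrr.
have T0 : T 0%N = 0 by rewrite /T expr1; ring.
have TS t : T t.+1 = X * (a t.+1 + 1) + T t by rewrite /T /a !exprS; ring.
have b0 : b 0%N = 0 by rewrite /b expr0 mulr0n; ring.
have U0 : U 0%N = 0 by rewrite /U expr0; ring.
have US t : U t.+1 = X * (b t.+1 + 1) + U t.
  by rewrite /U /b -!natr1 !exprS; ring.
have aE t : (1 + X) * a t - T t = (fun=> 0) t.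
  by rewrite /T /a exprS; ring.
have bE t : (1 + X) * b t - U t = a t.
  by rewrite /U /b /a; case: t => [|t]; rewrite -?natr1 ?exprS /=; ring.
have Qv : Q *m even_letter_cv _ = alt_cv a.
  rewrite -[RHS]mul1mx -QN -mulmxA (rise_alt_cv a _ T a0 T0 TS aE).
  congr (_ *m _); apply/matrixP => i j; rewrite !mxE.
  by case: (odd i).
have QQv : Q *m alt_cv a = alt_cv b.
  by rewrite -[RHS]mul1mx -QN -mulmxA (rise_alt_cv b a U b0 U0 US bE).
rewrite Qv QQv (sum_alt_cv a T) // (sum_alt_cv b U) //.
(* Here [1 - T k./2] is the denominator and [U k./2] the numerator. *)
rewrite /T /U [X + 1]addrC => <-; congr (_ * _); ring.
Qed.

(** * From traces to the generating function *)

Lemma num_cyclic_odd_up_mxtrace (n : nat) : (2 <= n)%N ->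
  (num_cyclic_odd_up k n)%:R = \tr (rel_mx rat k odd_up_rel ^+ n).
Proof.
case: n => // n lt0n; rewrite -sum_cycle_rel_mx /num_cyclic_odd_up -sum1_card.
rewrite natr_sum big_mkcond; apply: eq_bigr => w _.
rewrite inE /cyclic_odd_up leqNgt lt0n /= cycle_tnth.
by case: (boolP [forall i, _]).
Qed.

Lemma num_cyclic_odd_up0 : num_cyclic_odd_up k 0 = 1%N.
Proof.
have -> : num_cyclic_odd_up k 0 = #|[set: 0.-tuple 'I_k]|.
  by apply: eq_card => w; rewrite !inE.
by rewrite cardsT card_tuple.
Qed.

Lemma num_cyclic_odd_up1 : num_cyclic_odd_up k 1 = k.
Proof.
have -> : num_cyclic_odd_up k 1 = #|[set: 1.-tuple 'I_k]|.
  by apply: eq_card => w; rewrite !inE.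
by rewrite cardsT card_tuple card_ord expn1.
Qed.

Lemma sum_odd_ord : \sum_(i < k) (odd i : nat) = k./2.
Proof.
elim: k => [|n IHn]; first by rewrite big_ord0.
by rewrite big_ord_recr /= IHn; lia.
Qed.

Lemma mxtrace_odd_up : \tr (rel_mx rat k odd_up_rel) = k./2%:R.
Proof.
rewrite -sum_odd_ord natr_sum; apply: eq_bigr => i _.
by rewrite mxE /odd_up_rel /letter ltnn implybF /= negbK.
Qed.

(* The trace misses only the one-letter words, where a non-loop (an odd letter)
   is counted by convention. *)
Lemma cyclic_odd_up_gfE :
  cyclic_odd_up_gf k =
    1 + X * (uphalf k)%:R + (\tr (geom_mx rat k (rel_mx rat k odd_up_rel)) - k%:R).
Proof.
apply/fpsP => -[|[|n]]; rewrite !fps_coefD fps_coefN fps_coef_mxtrace_geom.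
- rewrite fps_coefXM0 fps_natr fps_coefC /= num_cyclic_odd_up0 mxtrace1.
  by rewrite subrr !addr0.
- rewrite fps_coefXMS !fps_natr !fps_coefC /= num_cyclic_odd_up1 expr1 mxtrace_odd_up.
  by rewrite add0r subr0 -natrD; congr (_%:R); lia.
rewrite fps_coefXMS !fps_natr !fps_coefC /= num_cyclic_odd_up_mxtrace //.
by rewrite !add0r subr0.
Qed.

End OddUp.

Theorem theorem4 (k : nat) (hk : (2 <= k)%N) :
  cyclic_odd_up_gf k =
    1 + fpsX *
      (((k + 1) %/ 2)%N%:R +
       (((k + 2) %/ 2)%N%:R * (fpsX + 1) ^+ (k %/ 2)%N - 1) /
       (fpsX + 2 - (fpsX + 1) ^+ ((k + 2) %/ 2)%N)).
Proof.
have -> : ((k + 1) %/ 2)%N = uphalf k by lia.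
have -> : ((k + 2) %/ 2)%N = (k./2).+1 by lia.
have -> : (k %/ 2)%N = k./2 by lia.
rewrite cyclic_odd_up_gfE mulrDr [RHS]addrA; congr (_ + _).
(* What remains equates the trace part with the quotient; the denominator is a unit, so it can be
   cleared. *)
have D_unit := denominator_unit (k./2).+1.
apply: (mulrI D_unit); rewrite mxtrace_geom_odd_up mulrCA; congr (_ * _).
by rewrite mulrCA divrr // mulr1.
Qed.
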